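(* Let $x_1,x_2,\tilde y_1,y_2,u_1,u_2,\tilde v_1,v_2,w_{\rm e},w_{\rm o},z_{\rm e},z_{\rm o}$ be commuting indeterminates and for $n\ge0$ let \[ \widetilde{P}'_n=\sum_{\sigma\in\mathfrak{D}_{2n}}x_1^{\mathrm{ereccpeak}'}x_2^{\mathrm{eareccdfall}'}\tilde y_1^{\mathrm{minval}}y_2^{\mathrm{ereccdrise}'}u_1^{\mathrm{nrcpeak}'}u_2^{\mathrm{nrcdfall}'}\tilde v_1^{\mathrm{nminval}}v_2^{\mathrm{nrcdrise}'}w_{\rm e}^{\mathrm{evennrfix}}w_{\rm o}^{\mathrm{oddnrfix}}z_{\rm e}^{\mathrm{evenrar}}z_{\rm o}^{\mathrm{oddrar}}, \] \[ \widetilde{P}_n=\sum_{\sigma\in\mathfrak{D}_{2n}}x_1^{\mathrm{eareccpeak}}x_2^{\mathrm{eareccdfall}}\tilde y_1^{\mathrm{minval}}y_2^{\mathrm{ereccdrise}}u_1^{\mathrm{nrcpeak}}u_2^{\mathrm{nrcdfall}}\tilde v_1^{\mathrm{nminval}}v_2^{\mathrm{nrcdrise}}w_{\rm e}^{\mathrm{evennrfix}}w_{\rm o}^{\mathrm{oddnrfix}}z_{\rm e}^{\mathrm{evenrar}}z_{\rm o}^{\mathrm{oddrar}}. \] Then $\sum_{n\ge0}\widetilde{P}'_nt^n$ equals the T-fraction $\cfrac{1}{1-\delta_1t-\cfrac{\alpha_1t}{1-\delta_2t-\cfrac{\alpha_2t}{1-\cdots}}}$ with, for $k\ge1$, $\alpha_{2k-1}=[x_1+(k-1)u_1][\tilde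 y_1+(k-1)\tilde v_1]$, $\alpha_{2k}=[x_2+(k-1)u_2+w_{\rm e}][y_2+(k-1)v_2+w_{\rm o}]$, $\delta_1=z_{\rm e}z_{\rm o}$, $\delta_n=0$ for $n\ge2$ (the same T-fraction as for $\widetilde{P}_n$); therefore $\widetilde{P}'_n=\widetilde{P}_n$ for all $n\ge0$.
   Context: A D-permutation of $[2n]$: $\sigma(2k-1)\ge2k-1$ and $\sigma(2k)\le2k$ for all $k$; $\mathfrak{D}_{2n}$ is their set. Cycle peak: $\sigma^{-1}(i)<i>\sigma(i)$; cycle valley: $\sigma^{-1}(i)>i<\sigma(i)$; cycle double rise: $\sigma^{-1}(i)<i<\sigma(i)$; cycle double fall: $\sigma^{-1}(i)>i>\sigma(i)$. Record: $\sigma(j)<\sigma(i)$ for all $j<i$; antirecord: $\sigma(j)>\sigma(i)$ for all $j>i$; exclusive record/antirecord = one but not the other; record-antirecord = both. Unprimed: $\mathrm{eareccpeak},\mathrm{eareccdfall}$ count cycle peaks, double falls $i$ that are exclusive antirecords; $\mathrm{ereccdrise}$ counts cycle double rises $i$ that are exclusive records; $\mathrm{nrcpeak},\mathrm{nrcdfall},\mathrm{nrcdrise}$ count cycle peaks, double falls, double rises $i$ that are neither records nor antirecords. Primed: $\mathrm{ereccpeak}'$ counts cycle peaks $i$ with $\sigma^{-1}(i)$ an exclusive record; $\mathrm{eareccdfall}'$ counts cycle double falls $i$ with $\sigma^{-1}(i)$ an exclusive antirecord; $\mathrm{ereccdrise}'$ counts cycle double rises $i$ with $\sigma^{-1}(i)$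 an exclusive record; $\mathrm{nrcpeak}',\mathrm{nrcdfall}',\mathrm{nrcdrise}'$ count cycle peaks, double falls, double rises $i$ with $\sigma^{-1}(i)$ neither a record nor an antirecord. $\mathrm{minval}$ counts cycle valleys that are the minimum of their cycle, $\mathrm{nminval}$ the other cycle valleys; $\mathrm{evennrfix}$/$\mathrm{oddnrfix}$ count even/odd fixed points that are neither records nor antirecords; $\mathrm{evenrar}$/$\mathrm{oddrar}$ count even/odd record-antirecords. *)

(* Defs.v *)
From mathcomp Require Import all_boot all_order all_fingroup all_algebra.

Set Implicit Arguments.
Unset Strict Implicit.
Unset Printing Implicit Defensive.

Import GRing.Theory.
Local Open Scope ring_scope.

Section Permutations.
Variable m : nat.
Implicit Types (s : 'S_m) (i : 'I_m).

(* The ordinal i : 'I_m stands for the letter i.+1 of [m] = {1, ..., m}:     *)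
(* comparisons of letters are comparisons of ordinals, but parity is that of *)
(* the letter.                                                               *)
Definition letter i : nat := i.+1.

Definition prec s i : 'I_m := (s^-1)%g i.

Definition cpeak s i := (prec s i < i)%N && (s i < i)%N.
Definition cval s i := (i < prec s i)%N && (i < s i)%N.
Definition cdrise s i := (prec s i < i)%N && (i < s i)%N.
Definition cdfall s i := (i < prec s i)%N && (s i < i)%N.
Definition fixpt s i := s i == i.

Definition record s i := [forall j : 'I_m, (j < i)%N ==> (s j < s i)%N].
Definition antirecord s i := [forall j : 'I_m, (i < j)%N ==> (s i < s j)%N].
Definition exrec s i := record s i && ~~ antirecord s i.
Definition exarec s i := antirecord s i && ~~ record s i.
Definition rar s i := record s i && antirecord s i.
Definition nrar s i := ~~ record s i && ~~ antirecord s i.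

Definition cycle_min s i := [forall j in porbit s i, (i <= j)%N].

Definition eareccpeak s := #|[set i | cpeak s i & exarec s i]|.
Definition eareccdfall s := #|[set i | cdfall s i & exarec s i]|.
Definition ereccdrise s := #|[set i | cdrise s i & exrec s i]|.
Definition nrcpeak s := #|[set i | cpeak s i & nrar s i]|.
Definition nrcdfall s := #|[set i | cdfall s i & nrar s i]|.
Definition nrcdrise s := #|[set i | cdrise s i & nrar s i]|.

Definition ereccpeak' s := #|[set i | cpeak s i & exrec s (prec s i)]|.
Definition eareccdfall' s := #|[set i | cdfall s i & exarec s (prec s i)]|.
Definition ereccdrise' s := #|[set i | cdrise s i & exrec s (prec s i)]|.
Definition nrcpeak' s := #|[set i | cpeak s i & nrar s (prec s i)]|.
Definition nrcdfall' s := #|[set i | cdfall s i & nrar s (prec s i)]|.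
Definition nrcdrise' s := #|[set i | cdrise s i & nrar s (prec s i)]|.

Definition minval s := #|[set i | cval s i & cycle_min s i]|.
Definition nminval s := #|[set i | cval s i & ~~ cycle_min s i]|.

Definition evennrfix s :=
  #|[set i | [&& fixpt s i, nrar s i & ~~ odd (letter i)]]|.
Definition oddnrfix s :=
  #|[set i | [&& fixpt s i, nrar s i & odd (letter i)]]|.
Definition evenrar s := #|[set i | rar s i & ~~ odd (letter i)]|.
Definition oddrar s := #|[set i | rar s i & odd (letter i)]|.

Definition Dperm : {set 'S_m} :=
  [set s : 'S_m | [forall i : 'I_m,
     if odd (letter i) then (i <= s i)%N else (s i <= i)%N]].

End Permutations.

Section Polynomials.
Variable R : comNzRingType.
Variables (x1 x2 y1 y2 u1 u2 v1 v2 we wo ze zo : R).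

(* y1 and v1 are the tilded variables. *)
Definition Ptilde' (n : nat) : R :=
  \sum_(s in Dperm (2 * n)%N)
    x1 ^+ ereccpeak' s * x2 ^+ eareccdfall' s *
    y1 ^+ minval s * y2 ^+ ereccdrise' s *
    u1 ^+ nrcpeak' s * u2 ^+ nrcdfall' s *
    v1 ^+ nminval s * v2 ^+ nrcdrise' s *
    we ^+ evennrfix s * wo ^+ oddnrfix s *
    ze ^+ evenrar s * zo ^+ oddrar s.

Definition Ptilde (n : nat) : R :=
  \sum_(s in Dperm (2 * n)%N)
    x1 ^+ eareccpeak s * x2 ^+ eareccdfall s *
    y1 ^+ minval s * y2 ^+ ereccdrise s *
    u1 ^+ nrcpeak s * u2 ^+ nrcdfall s *
    v1 ^+ nminval s * v2 ^+ nrcdrise s *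
    we ^+ evennrfix s * wo ^+ oddnrfix s *
    ze ^+ evenrar s * zo ^+ oddrar s.

(* Coefficients are numbered from 1, as in the T-fraction; the value at 0 is *)
(* never used. Both j = 2k-1 and j = 2k have uphalf j = k.                   *)
Definition alpha (j : nat) : R :=
  let k := uphalf j in
  if odd j then (x1 + k.-1%:R * u1) * (y1 + k.-1%:R * v1)
  else (x2 + k.-1%:R * u2 + we) * (y2 + k.-1%:R * v2 + wo).

Definition delta (j : nat) : R := if j == 1%N then ze * zo else 0.

End Polynomials.

(* A formal power series in t over R is its coefficient sequence nat -> R.   *)
Section PowerSeries.
Variable R : comNzRingType.
Implicit Types f g : nat -> R.

Definition fps_mul f g : nat -> R :=
  fun n => \sum_(i < n.+1) f i * g (n - i)%N.

(* The first n coefficients of 1 / f, for f with constant term 1, given by   *)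
(* g_0 = 1 and g_m = - \sum_(i < m) f_(m - i) g_i for m > 0.                 *)
Fixpoint fps_inv_seq f (n : nat) : seq R :=
  if n is m.+1 then
    let g := fps_inv_seq f m in
    rcons g ((m == 0%N)%:R - \sum_(i < m) f (m - i)%N * g`_i)
  else [::].

Definition fps_inv f : nat -> R := fun n => (fps_inv_seq f n.+1)`_n.

Lemma size_fps_inv_seq f n : size (fps_inv_seq f n) = n.
Proof. by elim: n => //= n IHn; rewrite size_rcons IHn. Qed.

Lemma nth_fps_inv_seq f n i : (i < n)%N -> (fps_inv_seq f n)`_i = fps_inv f i.
Proof.
elim: n => // n IHn; rewrite ltnS leq_eqVlt => /predU1P[-> //|lt_in].
by rewrite /= nth_rcons size_fps_inv_seq lt_in IHn.
Qed.

Lemma fps_mul_inv f : f 0%N = 1 -> fps_mul f (fps_inv f) =1 fun n => (n == 0%N)%:R.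
Proof.
move=> f0 n; rewrite /fps_mul big_ord_recl f0 mul1r subn0.
rewrite {1}/fps_inv /= nth_rcons size_fps_inv_seq ltnn eqxx.
rewrite [X in _ - X](eq_bigr (fun i : 'I_n => f (n - i)%N * fps_inv f i)); last first.
  by move=> i _; rewrite nth_fps_inv_seq.
rewrite [X in _ - X](reindex_inj rev_ord_inj) /= -addrA [X in _ + X](_ : _ = 0) ?addr0 //.
apply/eqP; rewrite addrC subr_eq0; apply/eqP/eq_bigr => i _.
by rewrite subKn.
Qed.

(* The series 1 - d t - a t g(t). *)
Definition Tdenom (d a : R) g : nat -> R :=
  fun n => if n is m.+1 then - (d *+ (m == 0%N)) - a * g m else 1.

(* The tail 1 / (1 - d_k t - a_k t / (1 - d_(k+1) t - a_(k+1) t / ...)) with *)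
(* only its first N levels kept, i.e. with a_(k+N-1) replaced by 0.          *)
Fixpoint Ttrunc (a d : nat -> R) (k N : nat) : nat -> R :=
  if N is N'.+1 then fps_inv (Tdenom (d k) (a k) (Ttrunc a d k.+1 N'))
  else fun=> 0.

(* f is the infinite T-fraction with coefficients a_1, a_2, ... and d_1,     *)
(* d_2, ...: the limit of the truncations in the t-adic topology.            *)
Definition is_Tfraction (a d : nat -> R) f : Prop :=
  forall n, exists N0, forall N, (N0 <= N)%N -> Ttrunc a d 1 N n = f n.

End PowerSeries.

(* Main.v *)
Require Import Defs.
From mathcomp Require Import all_boot all_order all_fingroup all_algebra.
From mathcomp Require Import zify ring.

(* Fix the cycle types of all letters. A permutation with these types amounts *)
(* to independent choices of its excedances and its antiexcedances. Choosing  *)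
(* the preimages of peaks and double rises in increasing order, then those of *)
(* valleys and double falls in decreasing order, there are h choices at a     *)
(* letter of height h, exactly one of which makes the preimage a record (an   *)
(* antirecord for a double fall). At a valley x, once all excedances and all  *)
(* antiexcedances with values > x are known, exactly one choice makes x the   *)
(* minimum of its cycle: the end of the path that starts at x, which stays    *)
(* above x (Deb's Laguerre digraph reading of Foata-Zeilberger). So the sum   *)
(* over the permutations with given types is a product of local weights, and  *)
(* summing over types gives a weighted path count. Inversion turns the        *)
(* unprimed statistics into the primed ones with double rises and double      *)
(* falls exchanged; both are level steps with the same number of choices, so  *)
(* the path count is unchanged. Reading two steps at a time, the generating   *)
(* series of the paths to height 0 are products of tails of the T-fraction.   *)

(** Both polynomials are identified with the coefficients of the same series [Tlimit]. [greedy_sum]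
    turns successive choices whose total weight does not depend on the past into a product;
    [step_choices], with [cycle_min_choice] at valleys, computes the factors, and [special_kind]
    identifies the distinguished choice with the statistic. [sum_permutations] then gives a path
    count, which [two_step_Tlimit] matches with the T-fraction. The unprimed case passes through
    [s^-1] by [kind_of_inv] and [special_inv]. *)

Set Implicit Arguments.
Unset Strict Implicit.
Unset Printing Implicit Defensive.
Import GRing.Theory.
Local Open Scope ring_scope.

(** * Sums over permutations built by successive choices *)

Section GreedySum.
Variables (R : comNzRingType) (T : finType) (r : T -> nat).
Variables (ok : T -> {perm T} -> bool) (g : T -> {perm T} -> R) (c : T -> R).
Hypothesis r_inj : injective r.
Hypothesis ok_local : forall x (p q : {perm T}),
  (forall y, (r y <= r x)%N -> p y = q y) -> ok x p = ok x q.
Hypothesis g_local : forall x (p q : {perm T}),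
  (forall y, (r y <= r x)%N -> p y = q y) -> g x p = g x q.
(** [tperm x y * p] sends [x] to [p y] and agrees with [p] at lower ranks. As [y] varies, [p y] runs
    over the values not taken at a lower rank, so this sums over all admissible images of [x]; the
    total must not depend on the earlier choices. *)
Hypothesis sum_choices : forall x p,
  (forall y, (r y < r x)%N -> ok y p) ->
  \sum_(y | (r x <= r y)%N && ok x (tperm x y * p)%g) g x (tperm x y * p)%g = c x.

Let agree k (p0 p : {perm T}) := [forall y, (r y < k)%N ==> (p y == p0 y)].
Let okfrom k p := [forall y, (k <= r y)%N ==> ok y p].

Lemma greedy_sum_from k p0 : (forall y, (r y < k)%N -> ok y p0) ->
  \sum_(p | agree k p0 p && okfrom k p) \prod_(x | (k <= r x)%N) g x p
  = \prod_(x | (k <= r x)%N) c x.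
Proof.
have [K ltK] : exists K, forall y, (r y < K)%N.
  by exists (\max_y r y).+1 => y; rewrite ltnS leq_bigmax.
move Ed: (K - k)%N => d; elim: d k p0 Ed => [|d IHd] k p0 Ed ok0.
  have none y : (k <= r y)%N = false by have := ltK y; lia.
  rewrite (big_pred1 p0) => [|p]; first by rewrite !big_pred0.
  have -> : okfrom k p by apply/forallP => y; rewrite none.
  rewrite andbT; apply/forallP/eqP => [eqp | -> y]; last by rewrite eqxx implybT.
  by apply/permP => y; apply/eqP/(implyP (eqp y)); rewrite ltnNge none.
have [x /eqP rx | nox] := pickP (fun x => r x == k); last first.
  have geS y : (k <= r y)%N = (k < r y)%N.
    by rewrite leq_eqVlt eq_sym nox.
  have ltS y : (r y < k)%N = (r y < k.+1)%N by rewrite ltnNge geS -leqNgt ltnS.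
  rewrite [RHS](eq_bigl _ _ geS) -(IHd k.+1 p0) => [||y]; last 2 first.
  - by lia.
  - by rewrite -ltS; apply: ok0.
  apply: eq_big => [p|p _]; last exact: eq_bigl.
  by congr (_ && _); apply: eq_forallb => y; rewrite ?ltS // geS.
have geS (y : T) : (k <= r y)%N && (y != x) = (k < r y)%N.
  have [->|ne] := eqVneq y x; first by rewrite -rx ltnn andbF.
  by rewrite andbT leq_eqVlt -rx (inj_eq r_inj) eq_sym (negPf ne).
rewrite (bigD1 x) ?rx //= [X in _ * X](eq_bigl _ _ geS).
rewrite -(@sum_choices x p0) ?rx // mulr_suml [RHS]big_mkcondr /=.
(* Split by the letter [y] with [p x = p0 y]. Agreement with [p0] below rank [k] forces [y] to have
   rank at least [k]; the new prefix is that of [tperm x y * p0]. *)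
rewrite (partition_big (fun p : {perm T} => p0^-1%g (p x)) (fun y => (k <= r y)%N)) /=; last first.
  move=> p /andP[/forallP agr _]; rewrite leqNgt; apply/negP => lt_y.
  have /implyP/(_ lt_y) := agr (p0^-1%g (p x)); rewrite permKV => /eqP/perm_inj eq_x.
  by rewrite eq_x rx ltnn in lt_y.
apply: eq_bigr => y le_y; set q := (tperm x y * p0)%g.
have qx : q x = p0 y by rewrite permM tpermL.
have qlt z : (r z < k)%N -> q z = p0 z.
  by move=> lt_z; rewrite permM tpermD //; apply: contraTneq lt_z => <-; rewrite -leqNgt ?rx.
have agrS p : agree k p0 p && (p0^-1%g (p x) == y) = agree k.+1 q p.
  apply/andP/forallP => [[/forallP agr /eqP eq_y] z | agr].
    apply/implyP; rewrite ltnS leq_eqVlt => /predU1P[|lt_z].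
      by rewrite -rx => /r_inj->; rewrite qx -eq_y permKV.
    by rewrite qlt //; apply: (implyP (agr z)).
  split; last first.
    have /implyP := agr x; rewrite rx ltnSn qx => /(_ isT)/eqP->.
    by rewrite permK.
  apply/forallP => z; apply/implyP => lt_z; rewrite -qlt //.
  by apply: (implyP (agr z)); rewrite ltnW // ltnS ltnW.
have okx p : agree k.+1 q p -> (ok x p = ok x q) * (g x p = g x q).
  move=> /forallP agr; have eq_pq z : (r z <= r x)%N -> p z = q z.
    by rewrite rx => le_z; apply/eqP/(implyP (agr z)).
  by rewrite (ok_local eq_pq) (g_local eq_pq).
have okS p : okfrom k p = ok x p && okfrom k.+1 p.
  apply/forallP/andP => [okp | [okp /forallP okp1] z].
    split; first by apply: (implyP (okp x)); rewrite rx.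
    by apply/forallP => z; apply/implyP => lt_z; apply: (implyP (okp z)); apply: ltnW.
  apply/implyP; rewrite leq_eqVlt => /predU1P[|]; last by apply/implyP/okp1.
  by rewrite -rx => /r_inj <-.
have [okq | nokq] := boolP (ok x q).
  rewrite -(IHd k.+1 q) => [||z]; last 2 first.
  - by lia.
  - rewrite ltnS leq_eqVlt => /predU1P[|lt_z]; first by rewrite -rx => /r_inj->.
    rewrite (@ok_local z _ p0) ?ok0 // => z' le_z'.
    by apply: qlt; apply: leq_ltn_trans lt_z.
  rewrite mulr_sumr; apply: eq_big => p.
    rewrite andbAC agrS okS; apply: andb_id2l => /okx[-> _].
    by rewrite okq.
  rewrite andbAC agrS => /andP[/okx[_ eqg] _].
  by rewrite (bigD1 x) ?rx //= eqg (eq_bigl _ _ geS).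
apply: big_pred0 => p; rewrite andbAC agrS okS.
by have [/okx[-> _]|//] := boolP (agree _ _ _); rewrite (negPf nokq).
Qed.

Lemma greedy_sum :
  \sum_(p | [forall x, ok x p]) \prod_x g x p = \prod_x c x.
Proof.
rewrite -(greedy_sum_from (k := 0) (p0 := 1%g)) //.
apply: eq_bigl => p.
rewrite (_ : agree _ _ _ = true); last by apply/forallP.
by apply: eq_forallb.
Qed.

End GreedySum.

(** * Cycle types and heights *)

(* The cycle type of a letter i: None for a fixed point, otherwise           *)
(* Some (i < s i, s^-1 i < i); so Some (true, false) is a cycle valley,      *)
(* Some (false, true) a cycle peak, Some (true, true) a cycle double rise    *)
(* and Some (false, false) a cycle double fall.                              *)
Notation kind := (option (bool * bool)).

(** Arcs from [i] to [s i] are upper for excedances and lower for antiexcedances; [pos] marks the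
    start of such an arc, [val] its end. *)
Definition upos (k : kind) := if k is Some (a, _) then a else false.
Definition uval (k : kind) := if k is Some (_, b) then b else false.
Definition lpos (k : kind) := if k is Some (a, _) then ~~ a else false.
Definition lval (k : kind) := if k is Some (_, b) then ~~ b else false.

Definition kind_of m (s : 'S_m) i : kind :=
  if s i == i then None else Some ((i < s i)%N, (prec s i < i)%N).

(* In the primed statistics, whether i carries the first or the second       *)
(* variable of its cycle type.                                               *)
Definition special m (s : 'S_m) i : bool :=
  match kind_of s i with
  | None => record s i
  | Some (true, false) => cycle_min s i
  | Some (_, true) => record s (prec s i)
  | Some (false, false) => antirecord s (prec s i)
  end.

Section Heights.
Variables (m : nat) (t : {ffun 'I_m -> kind}).

Definition count_below (P : kind -> bool) (i : nat) :=
  #|[set j : 'I_m | (j < i)%N && P (t j)]|.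

(** For the types of a permutation [s], this is the number of [j < i] with [i <= s j]. The
    subtraction is exact whenever [count_le] applies. *)
Definition height i := (count_below upos i - count_below uval i)%N.

Definition balanced := #|[set j | upos (t j)]| == #|[set j | uval (t j)]|.

Lemma count_belowS P (i : 'I_m) :
  count_below P i.+1 = (count_below P i + P (t i))%N.
Proof.
rewrite /count_below (cardsD1 i) inE ltnSn addnC /=; congr (#|pred_of_set _| + _)%N.
apply/setP => j; rewrite !inE ltnS ltn_neqAle.
by rewrite andbA.
Qed.

Lemma count_above P (i : 'I_m) :
  (#|[set j | P (t j)]|
   = count_below P i.+1 + #|[set j : 'I_m | (i < j)%N && P (t j)]|)%N.
Proof.
rewrite -(cardsID [set j : 'I_m | (j < i.+1)%N]); congr (_ + _)%N.
  by apply: eq_card => j; rewrite !inE andbC.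
by apply: eq_card => j; rewrite !inE -leqNgt.
Qed.

(** A letter that is not fixed starts exactly one arc and ends exactly one, so both sides count the
    letters above [i] that are not fixed. *)
Lemma lower_upper (i : 'I_m) :
  (#|[set j : 'I_m | (i < j)%N && lpos (t j)]|
     + #|[set j : 'I_m | (i < j)%N && upos (t j)]|
   = #|[set j : 'I_m | (i < j)%N && lval (t j)]|
     + #|[set j : 'I_m | (i < j)%N && uval (t j)]|)%N.
Proof.
have split (P Q : kind -> bool) : (forall k, ~~ (P k && Q k) && (P k || Q k == isSome k)) ->
    (#|[set j : 'I_m | (i < j)%N && P (t j)]| + #|[set j : 'I_m | (i < j)%N && Q (t j)]|
     = #|[set j : 'I_m | (i < j)%N && t j]|)%N.
  move=> PQ; rewrite -[RHS](cardsID [set j | P (t j)]); congr (_ + _)%N.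
    apply: eq_card => j; rewrite !inE.
    by case: (t j) (PQ (t j)) => [?|] /=; case: (P _); case: (Q _); rewrite ?andbF ?andbT.
  apply: eq_card => j; rewrite !inE.
  by case: (t j) (PQ (t j)) => [?|] /=; case: (P _); case: (Q _); rewrite ?andbF ?andbT.
by rewrite !split // => - [[[] []]|].
Qed.
End Heights.

Section FixedKinds.
Variables (m : nat) (t : {ffun 'I_m -> kind}).
Implicit Types (p q s : 'S_m) (x y j : 'I_m).

(** The order in which preimages are chosen: fixed points, then ends of upper arcs upwards, then
    ends of lower arcs downwards. *)
Definition rank x : nat :=
  match t x with
  | None => x
  | Some (_, true) => m + x
  | Some (_, false) => m + m + (m - x)
  end.

Lemma rank_inj : injective rank.
Proof.
move=> x y; rewrite /rank => E; apply/val_inj => /=; move: E.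
have := ltn_ord x; have := ltn_ord y.
by case: (t x) => [[? []]|]; case: (t y) => [[? []]|]; lia.
Qed.

Lemma rank_uval x y : uval (t x) -> uval (t y) -> (rank y < rank x)%N = (y < x)%N.
Proof.
rewrite /rank; case: (t x) => [[? []]|] //=; case: (t y) => [[? []]|] //= _ _.
by rewrite ltn_add2l.
Qed.

Lemma rank_lval x y : lval (t x) -> lval (t y) -> (rank y < rank x)%N = (x < y)%N.
Proof.
rewrite /rank; case: (t x) => [[? []]|] //=; case: (t y) => [[? []]|] //= _ _.
by rewrite ltn_add2l; have := ltn_ord x; have := ltn_ord y; lia.
Qed.

Lemma rank_uval_lval x y : lval (t x) -> ~~ lval (t y) -> (rank y < rank x)%N.
Proof.
have := ltn_ord x; have := ltn_ord y.
by rewrite /rank; case: (t x) => [[? []]|] //=; case: (t y) => [[? []]|] //=; lia.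
Qed.

Lemma rank_fix x y : t x = None -> (rank y < rank x)%N -> t y = None.
Proof.
have := ltn_ord x; have := ltn_ord y.
by rewrite /rank; case: (t x) => [[? []]|] //=; case: (t y) => [[? []]|] //=; lia.
Qed.

Lemma rank_fix_uval x y : uval (t x) -> t y = None -> (rank y < rank x)%N.
Proof.
have := ltn_ord x; have := ltn_ord y.
by rewrite /rank; case: (t x) => [[? []]|] //=; case: (t y) => [[? []]|] //=; lia.
Qed.

(* Here and below, p stands for s^-1. *)
Definition ok x p : bool :=
  match t x with
  | None => p x == x
  | Some (_, true) => (p x < x)%N && upos (t (p x))
  | Some (_, false) => (x < p x)%N && lpos (t (p x))
  end.

(** The candidates for [p x] when an upper arc ends at [x]: starts of upper arcs below [x] whose arc
    does not end below [x]. [free_above] is the mirror image. *)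
Definition free_below p x :=
  [set j : 'I_m | (j < x)%N && upos (t j)]
    :\: p @: [set y : 'I_m | (y < x)%N && uval (t y)].

Definition free_above p x :=
  [set j : 'I_m | (x < j)%N && lpos (t j)]
    :\: p @: [set y : 'I_m | (x < y)%N && lval (t y)].

Definition special_choice x p : bool :=
  match t x with
  | None => height t x == 0%N
  | Some (true, false) => cycle_min p x
  | Some (_, true) => [forall j in free_below p x, (p x <= j)%N]
  | Some (false, false) => [forall j in free_above p x, (j <= p x)%N]
  end.

Lemma free_below_local p q x :
  (forall y, uval (t y) -> (y < x)%N -> p y = q y) -> free_below p x = free_below q x.
Proof.
move=> eq_pq; congr (_ :\: _); apply: eq_in_imset => y; rewrite inE => /andP[? ?].
exact: eq_pq.
Qed.

Lemma free_above_local p q x :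
  (forall y, lval (t y) -> (x < y)%N -> p y = q y) -> free_above p x = free_above q x.
Proof.
move=> eq_pq; congr (_ :\: _); apply: eq_in_imset => y; rewrite inE => /andP[? ?].
exact: eq_pq.
Qed.

Lemma okN x p : t x = None -> ok x p = (p x == x).
Proof. by rewrite /ok => ->. Qed.

Lemma ok_uval x p : uval (t x) -> ok x p = (p x < x)%N && upos (t (p x)).
Proof. by rewrite /ok; case: (t x) => [[? []]|]. Qed.

Lemma ok_lval x p : lval (t x) -> ok x p = (x < p x)%N && lpos (t (p x)).
Proof. by rewrite /ok; case: (t x) => [[? []]|]. Qed.

Lemma kindP x : [\/ t x = None, uval (t x) | lval (t x)].
Proof.
by case: (t x) => [[? []]|]; [constructor 2 | constructor 3 | constructor 1].
Qed.

Lemma lpos_upos k : lpos k -> upos k = false.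
Proof. by case: k => [[[] ?]|]. Qed.

Lemma lval_uval k : lval k -> uval k = false.
Proof. by case: k => [[? []]|]. Qed.

Lemma free_below_sub p x : (forall y, uval (t y) -> (y < x)%N -> ok y p) ->
  p @: [set y : 'I_m | (y < x)%N && uval (t y)]
    \subset [set j : 'I_m | (j < x)%N && upos (t j)].
Proof.
move=> okp; apply/subsetP => _ /imsetP[y + ->]; rewrite !inE => /andP[lt_y uy].
have := okp _ uy lt_y; rewrite ok_uval // => /andP[lt_p ->].
by rewrite (ltn_trans lt_p).
Qed.

Lemma count_le p x : (forall y, uval (t y) -> (y < x)%N -> ok y p) ->
  (count_below t uval x <= count_below t upos x)%N.
Proof.
by move/free_below_sub/subset_leq_card; rewrite card_imset //; apply: perm_inj.
Qed.

Lemma card_free_below p x : (forall y, uval (t y) -> (y < x)%N -> ok y p) ->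
  #|free_below p x| = height t x.
Proof.
move=> okp; rewrite cardsD (setIidPr (free_below_sub okp)) card_imset //.
exact: perm_inj.
Qed.

Hypothesis bal : balanced t.

(** By [lower_upper] and balance, as many lower arcs as upper arcs cross the gap just above [x]. *)
Lemma card_free_above p x : (forall y, lval (t y) -> (x < y)%N -> ok y p) ->
  #|free_above p x| = height t x.+1.
Proof.
move=> okp; rewrite cardsD (setIidPr _); last first.
  apply/subsetP => _ /imsetP[y + ->]; rewrite !inE => /andP[lt_y uy].
  have := okp _ uy lt_y; rewrite ok_lval // => /andP[lt_p ->].
  by rewrite (ltn_trans lt_y).
rewrite card_imset; last exact: perm_inj.
have := lower_upper t x; move/eqP: bal.
rewrite (count_above t upos x) (count_above t uval x) /height.
have arith a b c d e f : (a + b = c + d -> e + b = f + d -> e - f = a - c)%N by lia.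
exact: arith.
Qed.

(** [p] injects the ends of upper arcs into their starts, and balance makes the two sets
    equinumerous. *)
Lemma upos_used p j : (forall y, uval (t y) -> ok y p) ->
  upos (t j) -> uval (t (p^-1%g j)).
Proof.
move=> okp uj.
have sub : p @: [set y | uval (t y)] \subset [set j | upos (t j)].
  apply/subsetP => _ /imsetP[y + ->]; rewrite !inE => uy.
  by have := okp _ uy; rewrite ok_uval // => /andP[].
have: j \in p @: [set y | uval (t y)].
  rewrite (_ : p @: _ = [set j | upos (t j)]) ?inE //.
  apply/eqP; rewrite eqEcard sub card_imset; last exact: perm_inj.
  by move/eqP: bal => ->; rewrite leqnn.
by case/imsetP => y; rewrite inE => uy ->; rewrite permK.
Qed.

Lemma ok_local x p q :
  (forall y, (rank y <= rank x)%N -> p y = q y) -> ok x p = ok x q.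
Proof. by move=> eq_pq; rewrite /ok eq_pq. Qed.

(** A cycle with minimum [x] visits only letters [>= x]. All of these have rank at most that of [x],
    so [q] follows the same cycle. This is what makes minimality a local condition. *)
Lemma cycle_min_imply x p q : lval (t x) ->
  (forall y, (rank y <= rank x)%N -> p y = q y) -> cycle_min p x -> cycle_min q x.
Proof.
move=> lx eq_pq /forallP minp; apply/forallP => j; apply/implyP => /porbitP[n ->].
suff -> : (q ^+ n)%g x = (p ^+ n)%g x by apply: (implyP (minp _)); apply: mem_porbit.
elim: n => // n IHn; rewrite !expgSr !permM IHn eq_pq //.
set y := (p ^+ n)%g x; have: (x <= y)%N by apply: (implyP (minp _)); apply: mem_porbit.
have [ly|/(rank_uval_lval lx)/ltnW //] := boolP (lval (t y)).
by rewrite [(rank _ <= _)%N]leqNgt rank_lval // -leqNgt.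
Qed.

Lemma special_choice_local x p q :
  (forall y, (rank y <= rank x)%N -> p y = q y) ->
  special_choice x p = special_choice x q.
Proof.
move=> eq_pq; rewrite /special_choice -(eq_pq x) //.
have below : uval (t x) -> free_below p x = free_below q x.
  by move=> ux; apply: free_below_local => y uy lt_y; apply/eq_pq/ltnW; rewrite rank_uval.
have above : lval (t x) -> free_above p x = free_above q x.
  by move=> ux; apply: free_above_local => y uy lt_y; apply/eq_pq/ltnW; rewrite rank_lval.
case tx: (t x) => [[[] []]|] //; rewrite ?below ?above ?tx //.
have lx : lval (t x) by rewrite tx.
apply/idP/idP; apply: cycle_min_imply => //.
by move=> y /eq_pq.
Qed.

(** Puts the candidates in the form in which [sum_choices] lists them. Fixed points come earlier but
    start no upper arc, and ends of lower arcs all come later. *)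
Lemma free_belowE p x j : (forall y, (rank y < rank x)%N -> ok y p) -> uval (t x) ->
  (j \in free_below p x)
  = [&& (rank x <= rank (p^-1%g j))%N, (j < x)%N & upos (t j)].
Proof.
move=> okp ux; set y := (p^-1%g j); have -> : j = p y by rewrite permKV.
rewrite !inE mem_imset; last exact: perm_inj.
rewrite inE; apply: andb_id2r => /andP[lt_j uj].
have [ty | uy | ly] := kindP y.
- have := okp y (rank_fix_uval ux ty); rewrite okN // => /eqP py.
  by move: uj; rewrite py ty.
- by rewrite uy andbT [RHS]leqNgt rank_uval.
rewrite (lval_uval ly) andbF; apply/esym/ltnW/rank_uval_lval => //.
by case: (t x) ux => [[? []]|].
Qed.

Lemma free_aboveE p x j : (forall y, (rank y < rank x)%N -> ok y p) -> lval (t x) ->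
  (j \in free_above p x)
  = [&& (rank x <= rank (p^-1%g j))%N, (x < j)%N & lpos (t j)].
Proof.
move=> okp lx; set y := (p^-1%g j); have -> : j = p y by rewrite permKV.
rewrite !inE mem_imset; last exact: perm_inj.
rewrite inE; apply: andb_id2r => /andP[lt_j uj].
have [ty | uy | ly] := kindP y.
- have := okp y; rewrite okN // rank_uval_lval ?ty // => /(_ isT)/eqP py.
  by move: uj; rewrite py ty.
- have := okp y; rewrite ok_uval // rank_uval_lval //; last by case: (t y) uy => [[? []]|].
  by case/(_ isT)/andP => _; rewrite lpos_upos.
by rewrite ly andbT [RHS]leqNgt rank_lval.
Qed.

End FixedKinds.

(** * Counting the choices at a letter *)

Section Choices.
Variables (m : nat) (t : {ffun 'I_m -> kind}).
Hypothesis bal : balanced t.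
Implicit Types (p q s : 'S_m) (x y j : 'I_m).

(* If all excedances and all antiexcedances with values > x are known, then  *)
(* the path of s that starts at the valley x stays above x until it reaches  *)
(* a position whose image is still free: sending it to x is the only choice  *)
(* that makes x the minimum of its cycle.                                    *)
Lemma cycle_min_choice p x : t x = Some (true, false) ->
  (forall y, (rank t y < rank t x)%N -> ok t y p) ->
  exists2 j0, j0 \in free_above t p x &
    {in free_above t p x, forall j,
      cycle_min (tperm x (p^-1%g j) * p)%g x = (j == j0)}.
Proof.
move=> tx okp; have lx : lval (t x) by rewrite tx.
set s := (p^-1)%g.
(* [n] is the first positive time at which the path of [s] from [x] meets a letter whose preimage is
   still to be chosen; such a time exists because the path returns to [x]. *)
have [|n /andP[n_gt0 le_n] min_n] :=
    @ex_minnP (fun n => (0 < n)%N && (rank t x <= rank t (iter n s x))%N).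
  by exists #[s]%g; rewrite order_gt0 -permX expg_order perm1 leqnn.
have lt_rank i : (0 < i < n)%N -> (rank t (iter i s x) < rank t x)%N.
  move=> /andP[i_gt0 lt_i]; rewrite ltnNge; apply: contraL lt_i => le_i.
  by rewrite -leqNgt min_n // i_gt0.
(* Before time [n] an upper arc only climbs, and a lower arc whose end is already settled ends above
   [x]. *)
have gt_x i : (0 < i < n)%N -> (x < iter i s x)%N.
  elim: i => // i IHi lt_i; have lt_r := lt_rank _ lt_i.
  have := okp _ lt_r; set v := iter i.+1 s x in lt_r *.
  have pv : p v = iter i s x by rewrite /v iterS permKV.
  have le_x : (x <= p v)%N.
    by rewrite pv; case: (i) IHi lt_i => // i' IHi' lt_i; apply/ltnW/IHi'; lia.
  have [tv | uv | lv] := kindP t v.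
  - rewrite okN // => /eqP eq_v; rewrite -eq_v ltn_neqAle le_x andbT.
    by apply: contraTneq lt_r => eq_x; rewrite -eq_v -(val_inj eq_x) ltnn.
  - by rewrite ok_uval // => /andP[lt_v _]; apply: leq_ltn_trans lt_v.
  - by move=> _; rewrite -(rank_lval lx lv).
set o := iter n s x in le_n *; set j0 := iter n.-1 s x.
have sj0 : s j0 = o by rewrite /j0 -iterS prednK.
have usedU j : upos (t j) -> (rank t (s j) < rank t x)%N.
  move=> uj; apply: rank_uval_lval => //.
  suff: uval (t (s j)) by case: (t _) => [[? []]|].
  apply: upos_used => // y uy; apply/okp/rank_uval_lval => //.
  by case: (t y) uy => [[? []]|].
(* The valley [x] starts an upper arc, and all upper arcs are already settled; so [j0] differs from
   [x]. *)
have n_neq1 : n != 1%N.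
  by apply: contraTneq le_n => n1; rewrite -ltnNge /o n1 /= usedU // tx.
have lt_n1 : (0 < n.-1 < n)%N by lia.
have j0_free : j0 \in free_above t p x.
  rewrite free_aboveE // -/s sj0 le_n gt_x //=.
  have lt_j0 := lt_rank _ lt_n1; rewrite -/j0 in lt_j0 *.
  have := usedU j0; rewrite sj0 ltnNge le_n /=.
  have := okp _ lt_j0; case tj0: (t j0) => [[[] b]|] //=; first by move=> _ /(_ isT).
  rewrite okN // => /eqP eq_j0.
  have eq_o : o = j0 by rewrite -sj0 -{1}eq_j0 /s permK.
  by rewrite -eq_o ltnNge le_n in lt_j0.
exists j0 => // j; rewrite free_aboveE // -/s => /and3P[le_sj _ _].
set y := s j in le_sj *; set q := (tperm x y * p)%g.
have le_x z : (rank t x <= rank t z)%N -> (z <= x)%N.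
  move=> le_z; rewrite leqNgt; apply/negP => lt_z.
  have [lz|nlz] := boolP (lval (t z)); first by move: lt_z; rewrite -(rank_lval lx lz) ltnNge le_z.
  by have := rank_uval_lval lx nlz; rewrite ltnNge le_z.
have iter_q i : (i < n)%N -> iter i (q^-1)%g x = iter i s x.
  elim: i => // i IHi lt_i; rewrite !iterS IHi ?(ltnW lt_i) // invMg tpermV permM.
  have lt_r : (rank t (iter i.+1 s x) < rank t x)%N by apply: lt_rank; rewrite lt_i.
  rewrite -[X in tperm _ _ X]/(iter i.+1 s x) tpermD //.
    by apply: contraTneq lt_r => <-; rewrite ltnn.
  by apply: contraTneq lt_r => <-; rewrite -leqNgt.
(* The swap first affects the path at time [n]: it closes up at [x] if [y = o], and otherwise
   reaches a letter below [x]. *)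
have iter_n : iter n (q^-1)%g x = tperm x y o.
  rewrite -(prednK n_gt0) iterS iter_q; last by lia.
  by rewrite invMg tpermV permM -/j0 -/s sj0.
have in_porbit i : iter i (q^-1)%g x \in porbit q x.
  by rewrite -porbitV -permX mem_porbit.
apply/forallP/eqP => [minq | eq_j].
  have {minq} : (x <= tperm x y o)%N by rewrite -iter_n; apply: (implyP (minq _)).
  apply: contraTeq => ne_j; rewrite -ltnNge.
  have ne_y : y != o by rewrite /y -sj0 (inj_eq perm_inj).
  have lt_x z : z != x -> (rank t x <= rank t z)%N -> (z < x)%N.
    by move=> ne_z /le_x; rewrite leq_eqVlt => /predU1P[/val_inj eq_z|//]; rewrite eq_z eqxx in ne_z.
  have [ox | ne_x] := eqVneq o x; first by rewrite ox tpermL lt_x // -ox.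
  by rewrite tpermD ?lt_x // eq_sym.
have iter_nx : iter n (q^-1)%g x = x.
  by rewrite iter_n /y eq_j sj0 tpermR.
have iter_lt i : exists2 k, (k < n)%N & iter i (q^-1)%g x = iter k (q^-1)%g x.
  elim: i => [|i [k lt_k eq_k]]; first by exists 0%N.
  have [lt_k1 | ge_k1] := ltnP k.+1 n; first by exists k.+1 => //; rewrite iterS eq_k.
  exists 0%N => //; rewrite iterS eq_k -iterS (_ : k.+1 = n) //.
  by apply/eqP; rewrite eqn_leq lt_k ge_k1.
move=> z; apply/implyP; rewrite -porbitV => /porbitP[i ->]; rewrite permX.
have [[|k] lt_k ->] := iter_lt i; first by [].
by rewrite iter_q // ltnW // gt_x.
Qed.

Section Sums.
Variable R : comNzRingType.

Lemma sum_one_special (U : {set 'I_m}) (sp : pred 'I_m) j0 (a b : R) :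
  j0 \in U -> {in U, sp =1 pred1 j0} ->
  \sum_(j in U) (if sp j then a else b) = a + #|U|.-1%:R * b.
Proof.
move=> U0 spE; rewrite (bigD1 j0) //= spE //= eqxx; congr (_ + _).
rewrite (eq_bigr (fun=> b)) => [|j /andP[Uj /negPf ne]]; last by rewrite spE //= ne.
rewrite (eq_bigl (mem (U :\ j0))) => [|j]; last by rewrite !inE andbC.
by rewrite sumr_const (cardsD1 j0 U) U0 mulr_natl.
Qed.

Lemma sum_min_special (U : {set 'I_m}) (a b : R) :
  \sum_(j in U) (if [forall i in U, (j <= i)%N] then a else b)
  = if #|U| is h.+1 then a + h%:R * b else 0.
Proof.
have [->|[i Ui]] := set_0Vmem U; first by rewrite big_set0 cards0.
have [j0 /= U0 min0] := arg_minnP (P := fun j => j \in U) (@nat_of_ord m) Ui.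
rewrite (sum_one_special (j0 := j0)) // => [|j Uj].
  by rewrite (cardsD1 j0) U0.
apply/forallP/eqP => [minj | -> k]; last by apply/implyP/min0.
by apply/val_inj/eqP; rewrite eqn_leq (implyP (minj j0)) // min0.
Qed.

Lemma sum_max_special (U : {set 'I_m}) (a b : R) :
  \sum_(j in U) (if [forall i in U, (i <= j)%N] then a else b)
  = if #|U| is h.+1 then a + h%:R * b else 0.
Proof.
have [->|[i Ui]] := set_0Vmem U; first by rewrite big_set0 cards0.
have [j0 /= U0 max0] := arg_maxnP (P := fun j => j \in U) (@nat_of_ord m) Ui.
rewrite (sum_one_special (j0 := j0)) // => [|j Uj].
  by rewrite (cardsD1 j0) U0.
apply/forallP/eqP => [maxj | -> k]; last by apply/implyP/max0.
by apply/val_inj/eqP; rewrite eqn_leq (implyP (maxj j0)) // max0.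
Qed.

Variable wt : nat -> kind -> bool -> R.

(** There are [h.+1] candidates at a valley and [h] at a peak, double rise or double fall, one of
    them special. A fixed point leaves no choice and is a record exactly at height 0. *)
Definition step_weight (i : nat) (k : kind) (h : nat) : R :=
  match k with
  | None => wt i k (h == 0%N)
  | Some (true, false) => wt i k true + h%:R * wt i k false
  | _ => if h is h'.+1 then wt i k true + h'%:R * wt i k false else 0
  end.

Lemma step_choices x p :
  (forall y, (rank t y < rank t x)%N -> ok t y p) ->
  \sum_(y | (rank t x <= rank t y)%N && ok t x (tperm x y * p)%g)
     wt x (t x) (special_choice t x (tperm x y * p)%g)
  = step_weight x (t x) (height t x).
Proof.
move=> okp.
have choice_eq j y : (rank t x <= rank t (p^-1%g j))%N -> (rank t y < rank t x)%N ->
    p y = (tperm x (p^-1%g j) * p)%g y.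
  move=> le_j lt_y; rewrite permM tpermD //.
    by apply: contraTneq lt_y => <-; rewrite ltnn.
  by apply: contraTneq lt_y => <-; rewrite -leqNgt.
have [tx | ux | lx] := kindP t x.
- rewrite (big_pred1 (p^-1%g x)) => [|y].
    by rewrite /special_choice /step_weight tx.
  rewrite okN // permM tpermL /= -(inj_eq (@perm_inj _ p^-1%g)) permK.
  apply: andb_idl => /eqP->; rewrite leqNgt; apply/negP => lt_y.
  have := okp _ lt_y; rewrite okN ?(rank_fix tx) // permKV => /eqP eq_x.
  by rewrite -eq_x ltnn in lt_y.
- have okU y : uval (t y) -> (y < x)%N -> ok t y p.
    by move=> uy lt_y; apply: okp; rewrite rank_uval.
  rewrite -(card_free_below okU).
  transitivity (\sum_(j in free_below t p x)
     (if [forall i in free_below t p x, (j <= i)%N] then wt x (t x) true else wt x (t x) false)).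
    rewrite (reindex_inj (@perm_inj _ p^-1%g)); apply: eq_big => j.
      by rewrite ok_uval // permM tpermL permKV free_belowE.
    move=> /andP[le_j _]; set q := (_ * p)%g; have qx : q x = j by rewrite permM tpermL permKV.
    have -> : special_choice t x q = [forall i in free_below t p x, (j <= i)%N].
      have -> : free_below t p x = free_below t q x.
        by apply: free_below_local => y uy lt_y; apply: choice_eq le_j _; rewrite rank_uval.
      by rewrite /special_choice -qx; case: (t x) ux => [[[] []]|].
    by case: ifP.
  rewrite sum_min_special /step_weight.
  by case: (t x) ux => [[[] []]|].
have okU y : lval (t y) -> (x < y)%N -> ok t y p.
  by move=> uy lt_y; apply: okp; rewrite rank_lval.
have := card_free_above bal okU; rewrite /height !count_belowS.
(* With this bound the truncated subtraction does grow by one across a valley. *)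
have le_h : (count_below t uval x <= count_below t upos x)%N.
  apply: (@count_le _ _ p) => y uy _; apply/okp/rank_uval_lval => //.
  by case: (t y) uy => [[? []]|].
have reind (sp : 'I_m -> bool) :
    (forall j, (rank t x <= rank t (p^-1%g j))%N -> j \in free_above t p x ->
       special_choice t x (tperm x (p^-1%g j) * p)%g = sp j) ->
    \sum_(y | (rank t x <= rank t y)%N && ok t x (tperm x y * p)%g)
      wt x (t x) (special_choice t x (tperm x y * p)%g)
    = \sum_(j in free_above t p x) (if sp j then wt x (t x) true else wt x (t x) false).
  move=> spE; rewrite (reindex_inj (@perm_inj _ p^-1%g)).
  have Ej j : (rank t x <= rank t (p^-1%g j))%N && ok t x (tperm x (p^-1%g j) * p)%g
              = (j \in free_above t p x).
    by rewrite ok_lval // permM tpermL permKV free_aboveE.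
  apply: eq_big => // j; rewrite Ej => Uj; rewrite spE //; first by case: ifP.
  by move: Uj; rewrite -Ej => /andP[].
case tx: (t x) lx => [[[] []]|] //= lx; rewrite ?addn0 ?addn1.
  have [j0 Uj0 minE] := cycle_min_choice tx okp.
  rewrite subSn // => cardU; rewrite -tx (reind (pred1 j0)); last first.
    by move=> j _ Uj; rewrite /special_choice tx minE.
  by rewrite (sum_one_special (j0 := j0)) // cardU tx.
move=> cardU; rewrite -tx (reind (fun j => [forall i in free_above t p x, (i <= j)%N])).
  by rewrite sum_max_special cardU tx.
move=> j le_j _; set q := (_ * p)%g; have qx : q x = j by rewrite permM tpermL permKV.
have -> : free_above t p x = free_above t q x.
  by apply: free_above_local => y uy lt_y; apply: choice_eq le_j _; rewrite rank_lval // tx.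
by rewrite /special_choice tx qx.
Qed.

End Sums.
End Choices.

(** * Summation over cycle types *)

Section KindOfPermutation.
Variable m : nat.
Implicit Types (s : 'S_m) (x y j : 'I_m) (t : {ffun 'I_m -> kind}).

Lemma prec_fix s x : (prec s x == x) = (s x == x).
Proof. by rewrite -[LHS](inj_eq (@perm_inj _ s)) permKV eq_sym. Qed.

Lemma upos_kind s x : upos (kind_of s x) = (x < s x)%N.
Proof. by rewrite /kind_of; case: eqP => //= ->; rewrite ltnn. Qed.

Lemma uval_kind s x : uval (kind_of s x) = (prec s x < x)%N.
Proof. by rewrite /kind_of -prec_fix; case: eqP => //= ->; rewrite ltnn. Qed.

Lemma lpos_kind s x : lpos (kind_of s x) = (s x < x)%N.
Proof.
by rewrite /kind_of; case: eqVneq => /= [->|ne]; rewrite ?ltnn // -leqNgt ltn_neqAle ne.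
Qed.

Lemma lval_kind s x : lval (kind_of s x) = (x < prec s x)%N.
Proof.
rewrite /kind_of -prec_fix eq_sym; case: eqVneq => /= [<-|ne]; rewrite ?ltnn //.
by rewrite -leqNgt ltn_neqAle ne.
Qed.

(** The condition at [x] determines how the arc ending at [x] goes, and the condition at [s x] how
    the arc starting at [x] goes. *)
Lemma ok_kind t s : [forall x, ok t x s^-1%g] = ([ffun x => kind_of s x] == t).
Proof.
apply/forallP/eqP => [okt | <- x]; last first.
  rewrite /ok !ffunE upos_kind lpos_kind -/(prec s x) /kind_of -prec_fix permKV.
  have [//|ne] := eqVneq (prec s x) x.
  have [lt_x|gt_x|/val_inj eq_x] := ltngtP (prec s x) x.
  - by case: (x < s x)%N.
  - by case: (x < s x)%N.
  by rewrite eq_x eqxx in ne.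
apply/ffunP => x; rewrite ffunE /kind_of -prec_fix.
have := okt x; rewrite /ok -/(prec s x); have := okt (s x); rewrite /ok permK.
case tx: (t x) => [[a b]|]; last by move=> _ ->.
move=> pos val.
have [eq_x|ne] := eqVneq (prec s x) x.
  by move: val; rewrite eq_x ltnn; case: (b).
have val_b : (prec s x < x)%N = b.
  case: (b) val => /andP[lt_x _] //; apply/negbTE; rewrite -leqNgt; exact: ltnW.
congr (Some (_, _)) => //.
case: (t (s x)) pos => [[? []]|] /=.
- by move=> /andP[-> /= ->].
- by move=> /andP[/ltnW + /= /negbTE->]; rewrite leqNgt => /negbTE.
by rewrite eq_sym -prec_fix (negPf ne).
Qed.

Lemma balanced_kind s : balanced [ffun x => kind_of s x].
Proof.
rewrite /balanced -(card_imset _ (@perm_inj _ s)); apply/eqP/eq_card => x; rewrite inE ffunE uval_kind.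
apply/imsetP/idP => [[j + ->]|lt_x]; first by rewrite inE ffunE upos_kind /prec permK.
by exists (prec s x); rewrite ?permKV // inE ffunE upos_kind permKV.
Qed.

Lemma free_below_kind s x j (t := [ffun x => kind_of s x]) :
  (j \in free_below t s^-1%g x) = (j < x <= s j)%N.
Proof.
rewrite !inE !ffunE upos_kind andbCA; apply: andb_id2l => lt_j.
apply/andP/idP => [[]|le_x].
  move=> notin lt_sj; rewrite leqNgt; apply: contra notin => lt_x.
  by apply/imsetP; exists (s j); rewrite ?permK // inE ffunE uval_kind lt_x /prec permK.
split; last exact: leq_trans le_x.
by apply/imsetP => -[y + eq_j]; rewrite inE {1}eq_j permKV in le_x * => /andP[]; rewrite ltnNge le_x.
Qed.

Lemma free_above_kind s x j (t := [ffun x => kind_of s x]) :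
  (j \in free_above t s^-1%g x) = (s j <= x < j)%N.
Proof.
rewrite !inE !ffunE lpos_kind [RHS]andbC andbCA; apply: andb_id2l => lt_j.
apply/andP/idP => [[]|le_x].
  move=> notin lt_sj; rewrite leqNgt; apply: contra notin => lt_x.
  by apply/imsetP; exists (s j); rewrite ?permK // inE ffunE lval_kind lt_x /prec permK.
split; last exact: leq_ltn_trans lt_j.
by apply/imsetP => -[y + eq_j]; rewrite inE {1}eq_j permKV in le_x * => /andP[]; rewrite ltnNge le_x.
Qed.

(** What keeps [prec s x] from being a record is an earlier position with value above [x], and such
    a position is a smaller candidate; antirecords are symmetric. A fixed point is a record when no
    upper arc passes over it. Inversion preserves cycles as sets. *)
Lemma special_kind s x (t := [ffun x => kind_of s x]) :
  special s x = special_choice t x s^-1%g.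
Proof.
have okt : forall y, ok t y s^-1%g by apply/forallP; rewrite ok_kind.
have recE : uval (kind_of s x) ->
    record s (prec s x) = [forall j in free_below t s^-1%g x, (prec s x <= j)%N].
  rewrite uval_kind => lt_x; apply: eq_forallb => j.
  rewrite free_below_kind permKV; case: (leqP (prec s x) j) => [_|lt_j].
    by rewrite implybT.
  by rewrite (ltn_trans lt_j lt_x) implybF /= -ltnNge.
have arecE : lval (kind_of s x) ->
    antirecord s (prec s x) = [forall j in free_above t s^-1%g x, (j <= prec s x)%N].
  rewrite lval_kind => lt_x; apply: eq_forallb => j.
  rewrite free_above_kind permKV; case: (leqP j (prec s x)) => [_|lt_j].
    by rewrite implybT.
  by rewrite (ltn_trans lt_x lt_j) implybF andbT /= -ltnNge.
have fixE : kind_of s x = None -> record s x = (height t x == 0%N).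
  rewrite /kind_of; case: eqP => // fx _.
  rewrite -(card_free_below (p := s^-1%g)) // cards_eq0.
  apply/forallP/eqP => [rec | free0 j]; last first.
    apply/implyP => lt_j; rewrite fx ltnNge; apply/negP => le_x.
    by have := in_set0 j; rewrite -free0 /t free_below_kind lt_j le_x.
  apply/setP => j; rewrite in_set0 /t free_below_kind; apply/negP => /andP[lt_j].
  by have /implyP/(_ lt_j) := rec j; rewrite fx ltnNge => /negP.
rewrite /special /special_choice !ffunE.
case k: (kind_of s x) => [[[] []]|]; rewrite -?recE -?arecE -?fixE ?k //.
by rewrite /cycle_min porbitV.
Qed.

Variables (R : comNzRingType) (wt : nat -> kind -> bool -> R).

Lemma sum_given_kinds t : balanced t ->
  \sum_(s : 'S_m | [ffun x => kind_of s x] == t)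
     \prod_(x < m) wt x (kind_of s x) (special s x)
  = \prod_(x < m) step_weight wt x (t x) (height t x).
Proof.
move=> bal.
rewrite -(greedy_sum (@rank_inj _ t) (ok := ok t)
  (g := fun x p => wt x (t x) (special_choice t x p))); first last.
- by move=> x p okp; apply: step_choices.
- by move=> x p q eq_pq; rewrite (special_choice_local eq_pq).
- by move=> x p q eq_pq; rewrite (ok_local eq_pq).
rewrite [RHS](reindex_inj invg_inj); apply: eq_big => s; first by rewrite ok_kind.
by move=> /eqP <-; apply: eq_bigr => x _; rewrite special_kind ffunE.
Qed.

Lemma sum_over_kinds :
  \sum_(s : 'S_m) \prod_(x < m) wt x (kind_of s x) (special s x)
  = \sum_(t | balanced t) \prod_(x < m) step_weight wt x (t x) (height t x).
Proof.
rewrite (partition_big (fun s : 'S_m => [ffun x => kind_of s x]) (@balanced m)) /=.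
  by apply: eq_bigr => t bal; apply: sum_given_kinds.
by move=> s _; apply: balanced_kind.
Qed.

(** The value [0.-1] for a peak at height 0 always comes with step weight 0. *)
Definition next_height (k : kind) h :=
  match k with
  | Some (true, false) => h.+1
  | Some (false, true) => h.-1
  | _ => h
  end.

Fixpoint path_sum (i r h : nat) : R :=
  if r is r'.+1 then
    \sum_(k : kind) step_weight wt i k h * path_sum i.+1 r' (next_height k h)
  else (h == 0%N)%:R.

(** Only a peak at height 0 could make the ends of upper arcs outnumber their starts, and its weight
    is zero. *)
Lemma heightS t x : (count_below t uval x <= count_below t upos x)%N ->
  step_weight wt x (t x) (height t x) != 0 ->
  (count_below t uval x.+1 <= count_below t upos x.+1)%N
    && (height t x.+1 == next_height (t x) (height t x)).
Proof.
rewrite /height !count_belowS; case: (t x) => [[[] []]|] /= le_h; try by move=> _; lia.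
set h := (_ - _)%N; case Eh: h => [|h']; rewrite ?eqxx // => _.
by move: Eh; rewrite /h; lia.
Qed.

Lemma count_below_eq t t' P (i : nat) : (forall x : 'I_m, (x < i)%N -> t x = t' x) ->
  count_below t P i = count_below t' P i.
Proof.
move=> eq_t; apply: eq_card => x; rewrite !inE; apply: andb_id2l => lt_x.
by rewrite eq_t.
Qed.

Lemma height_eq t t' (i : nat) : (forall x : 'I_m, (x < i)%N -> t x = t' x) ->
  height t i = height t' i.
Proof. by move=> eq_t; rewrite /height !(count_below_eq _ eq_t). Qed.

Lemma path_sum_from i r t0 : (i + r = m)%N ->
  (count_below t0 uval i <= count_below t0 upos i)%N ->
  \sum_(t : {ffun 'I_m -> kind} | [forall x : 'I_m, (x < i)%N ==> (t x == t0 x)] && balanced t)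
     \prod_(x < m | (i <= x)%N) step_weight wt x (t x) (height t x)
  = path_sum i r (height t0 i).
Proof.
elim: r i t0 => [|r IHr] i t0 Ei le_h.
  have all_lt (x : 'I_m) : (x < i)%N by have := ltn_ord x; lia.
  have eq1 (t : {ffun 'I_m -> kind}) : [forall x : 'I_m, (x < i)%N ==> (t x == t0 x)] = (t == t0).
    apply/forallP/eqP => [eq_t | -> x]; last by rewrite eqxx implybT.
    by apply/ffunP => x; apply/eqP/(implyP (eq_t x))/all_lt.
  (* [le_h] excludes truncation, so height 0 at the end really means equal counts. *)
  have bal0 : balanced t0 = (height t0 i == 0%N).
    have cnt P : #|[set j | P (t0 j)]| = count_below t0 P i.
      by apply: eq_card => x; rewrite !inE all_lt.
    by rewrite /balanced !cnt /height; lia.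
  rewrite /= (eq_bigl (fun t => (t == t0) && balanced t0)) => [|t]; last first.
    by rewrite eq1; apply: andb_id2l => /eqP->.
  rewrite big_mkcondr big_pred1_eq bal0; case: eqP => // _.
  by rewrite big_pred0 // => x; rewrite leqNgt all_lt.
have lt_i : (i < m)%N by lia.
pose x0 := Ordinal lt_i.
rewrite /= (partition_big (fun t : {ffun 'I_m -> kind} => t x0) xpredT) //=.
apply: eq_bigr => k _.
pose t1 : {ffun 'I_m -> kind} := [ffun x => if x == x0 then k else t0 x].
have t1_lt (x : 'I_m) : (x < i)%N -> t1 x = t0 x.
  by move=> lt_x; rewrite ffunE; case: eqP => // eq_x; rewrite eq_x ltnn in lt_x.
have t1_x0 : t1 x0 = k by rewrite ffunE eqxx.
have agreeS (t : {ffun 'I_m -> kind}) : [forall x : 'I_m, (x < i)%N ==> (t x == t0 x)] && (t x0 == k)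
    = [forall x : 'I_m, (x < i.+1)%N ==> (t x == t1 x)].
  apply/andP/forallP => [[/forallP agr /eqP tx0] x | agr].
    apply/implyP; rewrite ltnS leq_eqVlt => /predU1P[eq_x|lt_x].
      by rewrite (_ : x = x0) ?t1_x0 ?tx0 //; apply: val_inj.
    by rewrite t1_lt //; apply: (implyP (agr x)).
  split; last by have /implyP/(_ (ltnSn i)) := agr x0; rewrite t1_x0.
  apply/forallP => x; apply/implyP => lt_x; rewrite -t1_lt //.
  by apply: (implyP (agr x)); rewrite ltnW.
transitivity (\sum_(t : {ffun 'I_m -> kind} | [forall x : 'I_m, (x < i.+1)%N ==> (t x == t1 x)] && balanced t)
    (step_weight wt i k (height t0 i)
     * \prod_(x < m | (i.+1 <= x)%N) step_weight wt x (t x) (height t x))).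
  apply: eq_big => t; first by rewrite andbAC agreeS.
  rewrite andbAC agreeS => /andP[/forallP agr _].
  rewrite (bigD1 x0) ?leqnn //=; congr (_ * _).
    have /implyP/(_ (ltnSn i))/eqP-> := agr x0; rewrite t1_x0.
    congr (step_weight _ _ _ _); apply: height_eq => x lt_x.
    by have /implyP/(_ (ltnW lt_x))/eqP-> := agr x; rewrite t1_lt.
  apply: eq_bigl => x; rewrite andbC [RHS]ltn_neqAle; congr (_ && _).
  by rewrite eq_sym.
rewrite -mulr_sumr.
(* A type of zero weight contributes nothing to either side; for any other, [heightS] supplies the
   premise of the induction hypothesis. *)
have [-> | nz] := eqVneq (step_weight wt i k (height t0 i)) 0; first by rewrite !mul0r.
have eq_h : height t1 x0 = height t0 i by apply: height_eq.
have /andP[le_h1 /eqP eq_h1] : (count_below t1 uval i.+1 <= count_below t1 upos i.+1)%N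
    && (height t1 i.+1 == next_height k (height t0 i)).
  have := @heightS t1 x0; rewrite eq_h t1_x0; apply => //.
  by rewrite !(count_below_eq _ t1_lt).
by rewrite IHr ?eq_h1 // addSnnS.
Qed.

Lemma sum_permutations :
  \sum_(s : 'S_m) \prod_(x < m) wt x (kind_of s x) (special s x) = path_sum 0 m 0.
Proof.
have cb0 t P : count_below t P 0 = 0%N by apply: eq_card0 => x; rewrite !inE.
rewrite sum_over_kinds; have := @path_sum_from 0 m [ffun=> None] (add0n m).
rewrite /height !cb0 => <- //; apply: eq_bigl => t.
by rewrite (_ : [forall x, _]) //; apply/forallP.
Qed.

End KindOfPermutation.

(** * T-fractions as formal power series *)

Section FormalSeries.
Variable R : comNzRingType.
Implicit Types f g h : nat -> R.

(** Commutativity and associativity of the series product are borrowed from polynomials by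
    truncation. *)
Lemma fps_mul_poly f g N n : (n < N)%N ->
  fps_mul f g n = ((\poly_(i < N) f i) * (\poly_(i < N) g i))`_n.
Proof.
move=> lt_n; rewrite coefM; apply: eq_bigr => i _; rewrite !coef_poly.
by rewrite !(leq_ltn_trans _ lt_n) // ?leq_subr // -ltnS.
Qed.

Lemma fps_mulC f g n : fps_mul f g n = fps_mul g f n.
Proof. by rewrite !(fps_mul_poly _ _ (ltnSn n)) mulrC. Qed.

Lemma eq_fps_mul f f' g g' n : (forall i, (i <= n)%N -> f i = f' i) ->
  (forall i, (i <= n)%N -> g i = g' i) -> fps_mul f g n = fps_mul f' g' n.
Proof.
move=> eq_f eq_g; apply: eq_bigr => i _.
by rewrite eq_f ?eq_g // ?leq_subr // -ltnS.
Qed.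

Lemma fps_mulA f g h n : fps_mul f (fps_mul g h) n = fps_mul (fps_mul f g) h n.
Proof.
have trunc f1 g1 (i : nat) : (i < n.+1)%N ->
    fps_mul f1 g1 i = (\poly_(j < n.+1) (fps_mul f1 g1 j))`_i.
  by move=> lt_i; rewrite coef_poly lt_i.
transitivity ((\poly_(i < n.+1) f i * (\poly_(i < n.+1) g i * \poly_(i < n.+1) h i))`_n).
  rewrite coefM; apply: eq_bigr => i _; rewrite coef_poly ltn_ord.
  by rewrite -fps_mul_poly // ltnS leq_subr.
rewrite mulrA coefM; apply: eq_bigr => i _.
by rewrite -fps_mul_poly // coef_poly ltnS leq_subr.
Qed.

Lemma fps_mulZr c f g n : fps_mul f (fun i => c * g i) n = c * fps_mul f g n.
Proof. by rewrite mulr_sumr; apply: eq_bigr => i _; rewrite mulrCA. Qed.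

Lemma fps_mulDr f g h n :
  fps_mul f (fun i => g i + h i) n = fps_mul f g n + fps_mul f h n.
Proof. by rewrite -big_split; apply: eq_bigr => i _; rewrite mulrDr. Qed.

Definition shift f (n : nat) : R := if n is n'.+1 then f n' else 0.

Lemma fps_mul_shift f g n : fps_mul f (shift g) n = shift (fps_mul f g) n.
Proof.
rewrite /fps_mul; case: n => [|n] /=; first by rewrite big_ord1 mulr0.
rewrite big_ord_recr /= subnn mulr0 addr0; apply: eq_bigr => i _.
by rewrite subSn // -ltnS.
Qed.

Definition one_series (n : nat) : R := (n == 0%N)%:R.

Lemma fps_mul1 f n : fps_mul f one_series n = f n.
Proof.
rewrite /fps_mul big_ord_recr /= subnn /one_series mulr1 big1 ?add0r // => i _.
by rewrite subn_eq0 leqNgt ltn_ord mulr0.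
Qed.

Lemma eq_fps_inv f f' n : (forall i, (i <= n)%N -> f i = f' i) ->
  fps_inv f n = fps_inv f' n.
Proof.
move=> eq_f; suff eq_seq N : (N <= n.+1)%N -> fps_inv_seq f N = fps_inv_seq f' N.
  by rewrite /fps_inv eq_seq.
elim: N => //= N IHN lt_N; rewrite IHN ?(ltnW lt_N) //; congr (rcons _ (_ - _)).
by apply: eq_bigr => i _; rewrite eq_f // (leq_trans (leq_subr _ _)).
Qed.

Section TFraction.
Variables a d : nat -> R.

(** Each further level enters with one more factor [t]. *)
Lemma Ttrunc_stable k N N' n : (n < N)%N -> (n < N')%N ->
  Ttrunc a d k N n = Ttrunc a d k N' n.
Proof.
elim: N k N' n => // N IHN k [//|N'] n lt_n lt_n' /=.
apply: eq_fps_inv => -[|i] //= lt_i; congr (_ - _ * _).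
by apply: IHN; apply: leq_trans lt_i _.
Qed.

Definition Tlimit k n := Ttrunc a d k n.+1 n.

Lemma Tlimit_is_Tfraction : is_Tfraction a d (Tlimit 1).
Proof. by move=> n; exists n.+1 => N lt_n; apply: Ttrunc_stable. Qed.

(** This is [F_k (1 - d_k t - a_k t F_(k+1)) = 1] with the denominator multiplied out. *)
Lemma Tlimit_rec k n :
  Tlimit k n = one_series n
    + shift (fun j => d k * Tlimit k j + a k * fps_mul (Tlimit k) (Tlimit k.+1) j) n.
Proof.
set D := Tdenom (d k) (a k) (Tlimit k.+1).
have TinvE j : Tlimit k j = fps_inv D j.
  apply: eq_fps_inv => -[|i] //= lt_i; congr (_ - _ * _).
  exact: Ttrunc_stable.
have DE i : D i = one_series i + shift (fun j => - d k * one_series j + - a k * Tlimit k.+1 j) i.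
  case: i => [|i]; first by rewrite /= addr0.
  by rewrite /= add0r mulNr mulr_natr mulNr.
have : fps_mul (Tlimit k) D n = one_series n.
  rewrite fps_mulC (eq_fps_mul (f' := D) (g' := fps_inv D)) //.
  exact: fps_mul_inv.
rewrite (eq_fps_mul (f' := Tlimit k) (fun i _ => erefl _) (fun i _ => DE i)).
rewrite fps_mulDr fps_mul1 fps_mul_shift => E.
rewrite -E -addrA; apply/esym/eqP; rewrite -subr_eq0; apply/eqP.
rewrite [X in X - _ = _]addrC addrK.
case: n {E} => [|n] /=; first by rewrite addr0.
rewrite fps_mulDr !fps_mulZr fps_mul1.
by rewrite addrACA !mulNr !addNr addr0.
Qed.
End TFraction.

End FormalSeries.

(* [G h] and [E h] count the paths that end at height 0 and start at height  *)
(* h, before an odd letter and before an even letter respectively.           *)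
Section TwoStepRecursion.
Variable R : comNzRingType.
Variables a d up down lev_o lev_e : nat -> R.
Hypotheses (a_odd : forall h, a h.*2.+1 = up h * down h.+1)
           (a_even : forall h, a h.*2.+2 = lev_e h.+1 * lev_o h.+1)
           (d1 : d 1 = lev_e 0 * lev_o 0)
           (d_gt1 : forall k, d k.+2 = 0).
Variables G E : nat -> nat -> R.
Hypotheses (G0 : forall h, G h 0 = (h == 0%N)%:R)
           (GS : forall h n, G h n.+1 = up h * E h.+1 n + lev_o h * E h n)
           (E0 : forall n, E 0 n = lev_e 0 * G 0 n)
           (ES : forall h n, E h.+1 n = lev_e h.+1 * G h.+1 n + down h.+1 * G h n).

Let F := Tlimit a d.

Let FE k n : F k n = one_series R n
    + shift (fun j => d k * F k j + a k * fps_mul (F k) (F k.+1) j) n.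
Proof. exact: Tlimit_rec. Qed.

(** Put height [h] at level [2h] before an odd letter and at [2h-1] before an even one: every letter
    becomes a unit rise or fall, and the dip from 0 to -1 and back is a level step of weight [d 1].
    [F k] counts excursions from level [k-1]. Cutting a path at its first passage to each lower
    level gives these products of tails. *)
Let Gf := fix Gf h : nat -> R := if h is h'.+1 then
   fun n => lev_o h * shift (fps_mul (F h.*2.+1) (fps_mul (F h.*2) (fun i => down h * Gf h' i))) n
   else F 1.
Let Ef h : nat -> R := if h is h'.+1 then
   fps_mul (F h.*2) (fun i => down h * Gf h' i) else fun n => lev_e 0 * F 1 n.

(** Expand the leading tail by [FE]: the constant term is an immediate fall, the product term a rise
    followed by a path from one level higher. *)
Let ESf h n : Ef h.+1 n = lev_e h.+1 * Gf h.+1 n + down h.+1 * Gf h n.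
Proof.
rewrite [LHS]fps_mulC.
rewrite (eq_fps_mul (fun i _ => erefl _) (fun i _ => FE h.+1.*2 i)).
rewrite fps_mulDr fps_mul1 addrC fps_mul_shift; congr (_ + _).
rewrite /= doubleS a_even d_gt1; case: n => [|n] /=; first by rewrite !mulr0.
rewrite fps_mulDr !fps_mulZr mul0r add0r -mulrA fps_mulA [in RHS]fps_mulC.
by do 2?congr (_ * _); apply: eq_fps_mul => // i _; apply: fps_mulC.
Qed.

Let GfS h n : Gf h n.+1 = up h * Ef h.+1 n + lev_o h * Ef h n.
Proof.
case: h => [|h].
  rewrite [LHS]FE /= add0r d1 addrC (a_odd 0) -mulrA; congr (_ + _); last by ring.
  congr (_ * _); rewrite [in RHS]fps_mulZr.
  by congr (_ * _); apply: fps_mulC.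
rewrite [LHS]/= -/(Ef h.+1) addrC.
rewrite fps_mulC (eq_fps_mul (fun i _ => erefl _) (fun i _ => FE h.+1.*2.+1 i)).
rewrite fps_mulDr fps_mul1 fps_mul_shift mulrDr; congr (_ + _).
rewrite [Ef h.+2 n]/= -/(Ef h.+1) !fps_mulZr fps_mul_shift.
case: n => [|n] /=; first by rewrite !mulr0.
rewrite d_gt1 a_odd fps_mulDr !fps_mulZr mul0r add0r.
rewrite [lev_o _ * _]mulrC -!mulrA [_ * lev_o _]mulrC; do 3!congr (_ * _).
by rewrite fps_mulA [RHS]fps_mulC; apply: eq_fps_mul => // i _; apply: fps_mulC.
Qed.

Let Gf0 h : Gf h 0 = (h == 0%N)%:R.
Proof. by case: h => [|h]; rewrite [LHS]/= ?mulr0 // -/(F 1 0) FE /= addr0. Qed.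

Lemma two_step_Tlimit n : G 0 n = Tlimit a d 1 n.
Proof.
rewrite -/(Gf 0%N n); suff: forall h, G h n = Gf h n by [].
elim: n => [|n IHn] h; first by rewrite G0 Gf0.
have eqE h' : E h' n = Ef h' n.
  by case: h' => [|h']; rewrite ?E0 ?ES ?ESf !IHn.
by rewrite GS GfS !eqE.
Qed.
End TwoStepRecursion.

(** * Records, weights and D-permutations *)

Section Records.
Variable m : nat.
Implicit Types (s : 'S_m) (i j k : 'I_m).

Lemma perm_stable s (A : {set 'I_m}) :
  (forall k, k \in A -> s k \in A) -> forall k, (s k \in A) = (k \in A).
Proof.
move=> stab k; rewrite -[RHS](mem_imset _ _ (@perm_inj _ s)).
suff -> : s @: A = A by [].
apply/eqP; rewrite eqEcard card_imset ?leqnn ?andbT; last exact: perm_inj.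
by apply/subsetP => _ /imsetP[j Aj ->]; apply: stab.
Qed.

(** Otherwise [s] would inject the letters from [j] on into those from [s j] on, a smaller set. *)
Lemma antirecordN s j : (j < s j)%N -> ~~ antirecord s j.
Proof.
move=> lt_j; apply/negP => /forallP arec.
have ge_sj k : (j <= k)%N -> (s j <= s k)%N.
  by rewrite leq_eqVlt => /predU1P[/val_inj->//|lt_k]; apply/ltnW/(implyP (arec k)).
have stab k : k \in [set k : 'I_m | (j <= k)%N] -> s k \in [set k : 'I_m | (j <= k)%N].
  by rewrite !inE => /ge_sj; apply/leq_trans/ltnW.
have := perm_stable stab (s^-1%g j).
by rewrite permKV !inE leqnn => /esym/ge_sj; rewrite permKV leqNgt lt_j.
Qed.

Lemma recordN s j : (s j < j)%N -> ~~ record s j.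
Proof.
move=> lt_j; apply/negP => /forallP rec.
have le_sj k : (k <= j)%N -> (s k <= s j)%N.
  by rewrite leq_eqVlt => /predU1P[/val_inj->//|lt_k]; apply/ltnW/(implyP (rec k)).
have stab k : k \in [set k : 'I_m | (k <= j)%N] -> s k \in [set k : 'I_m | (k <= j)%N].
  by rewrite !inE => /le_sj le_k; apply/(leq_trans le_k)/ltnW.
have := perm_stable stab (s^-1%g j).
by rewrite permKV !inE leqnn => /esym/le_sj; rewrite permKV leqNgt lt_j.
Qed.

(** At a record fixed point [s] preserves the set of letters below it, hence also the set of those
    above; the converse is symmetric. *)
Lemma record_fix s j : s j = j -> record s j = antirecord s j.
Proof.
move=> fj; apply/forallP/forallP => rec k; apply/implyP => lt_k.
  rewrite ltn_neqAle fj -{1}fj (inj_eq val_inj) (inj_eq perm_inj) neq_ltn lt_k /=.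
  have := @perm_stable s [set k : 'I_m | (k < j)%N] _ k; rewrite !inE => stab.
  rewrite leqNgt stab -?leqNgt ?(ltnW lt_k) // => i; rewrite !inE => lt_i.
  by rewrite -[X in (_ < nat_of_ord X)%N]fj (implyP (rec i)).
rewrite ltn_neqAle fj -{1}fj (inj_eq val_inj) (inj_eq perm_inj) neq_ltn lt_k /=.
have := @perm_stable s [set k : 'I_m | (j < k)%N] _ k; rewrite !inE => stab.
rewrite leqNgt stab -?leqNgt ?(ltnW lt_k) // => i; rewrite !inE => lt_i.
by rewrite -[X in (nat_of_ord X < _)%N]fj (implyP (rec i)).
Qed.

(** Inversion reflects the graph in the diagonal; both sides say that no point lies to the right of
    and below [(i, s i)]. *)
Lemma record_inv s i : record s^-1%g (s i) = antirecord s i.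
Proof.
apply/forallP/forallP => rec k; apply/implyP => lt_k.
  rewrite ltnNge leq_eqVlt negb_or (inj_eq val_inj) (inj_eq perm_inj) neq_ltn lt_k orbT /=.
  apply/negP => /(implyP (rec (s k))); rewrite !permK.
  by rewrite ltnNge ltnW.
rewrite permK ltnNge leq_eqVlt negb_or; apply/andP; split.
  by apply: contraTneq lt_k => /val_inj->; rewrite permKV ltnn.
by apply/negP => /(implyP (rec _)); rewrite permKV ltnNge ltnW.
Qed.

Lemma antirecord_inv s i : antirecord s^-1%g (s i) = record s i.
Proof. by rewrite -record_inv invgK permK. Qed.

(* In the unprimed statistics, whether i carries the first or the second     *)
(* variable of its cycle type.                                               *)
Definition special_pos s i : bool :=
  match kind_of s i with
  | None => record s i
  | Some (true, false) => cycle_min s i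
  | Some (true, true) => record s i
  | Some (false, _) => antirecord s i
  end.

Definition flip (k : kind) : kind := if k is Some (a, b) then Some (~~ b, ~~ a) else None.

Lemma kind_of_inv s i : kind_of s^-1%g i = flip (kind_of s i).
Proof.
rewrite /kind_of /prec invgK -/(prec s i) prec_fix; have := prec_fix s i.
case: (eqVneq (s i) i) => //= ne /negbT ne'; congr (Some (_, _)).
  by rewrite -leqNgt ltn_neqAle eq_sym ne'.
by rewrite -leqNgt ltn_neqAle ne.
Qed.

(** The predecessor of [i] under [s^-1] is [s i], so conditions on preimages become conditions on
    [i] itself, with records and antirecords exchanged. *)
Lemma special_inv s i : special s^-1%g i = special_pos s i.
Proof.
rewrite /special /special_pos kind_of_inv /prec invgK record_inv antirecord_inv.
rewrite /cycle_min porbitV.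
case E: (kind_of s i) => [[[] []]|] //=.
move: E; rewrite /kind_of; case: eqP => // fi _.
by rewrite (record_fix fi) -record_inv fi.
Qed.

End Records.

Section Weights.
Variables (R : comNzRingType).
Variables (x1 x2 y1 y2 u1 u2 v1 v2 we wo ze zo : R).

(** Types that a D-permutation forbids at a letter of the given parity weigh 0, so the sum extends
    to all permutations. *)
Definition weight (i : nat) (k : kind) (b : bool) : R :=
  match k with
  | None => if odd i.+1 then (if b then zo else wo) else (if b then ze else we)
  | Some (true, false) => if odd i.+1 then (if b then y1 else v1) else 0
  | Some (true, true) => if odd i.+1 then (if b then y2 else v2) else 0
  | Some (false, true) => if odd i.+1 then 0 else (if b then x1 else u1)
  | Some (false, false) => if odd i.+1 then 0 else (if b then x2 else u2)
  end.

Section Monomials.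
Variable m : nat.
Implicit Types (s : 'S_m) (i : 'I_m).

Lemma exp_card (x : R) (P : pred 'I_m) :
  x ^+ #|[set i | P i]| = \prod_i (if P i then x else 1).
Proof. by rewrite -big_mkcond -prodr_const; apply: eq_bigl => i; rewrite inE. Qed.

Lemma weight_prod s (q : pred 'I_m) : s \in Dperm m ->
  \prod_(i < m) weight i (kind_of s i) (q i) =
    x1 ^+ #|[set i | cpeak s i && q i]| * x2 ^+ #|[set i | cdfall s i && q i]| *
    y1 ^+ #|[set i | cval s i && q i]| * y2 ^+ #|[set i | cdrise s i && q i]| *
    u1 ^+ #|[set i | cpeak s i && ~~ q i]| * u2 ^+ #|[set i | cdfall s i && ~~ q i]| *
    v1 ^+ #|[set i | cval s i && ~~ q i]| * v2 ^+ #|[set i | cdrise s i && ~~ q i]| *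
    we ^+ #|[set i | [&& fixpt s i, ~~ q i & ~~ odd (letter i)]]| *
    wo ^+ #|[set i | [&& fixpt s i, ~~ q i & odd (letter i)]]| *
    ze ^+ #|[set i | [&& fixpt s i, q i & ~~ odd (letter i)]]| *
    zo ^+ #|[set i | [&& fixpt s i, q i & odd (letter i)]]|.
Proof.
rewrite inE => /forallP Ds; rewrite !exp_card -!big_split /=.
apply: eq_bigr => i _; have := Ds i; have := prec_fix s i.
rewrite /letter /cpeak /cdfall /cval /cdrise /fixpt /kind_of /weight.
rewrite -!(inj_eq val_inj) /=; case: (q i); case: (~~ odd i) => /=;
  case: ltngtP => // _; case: ltngtP => // _ _ _; by rewrite /= ?mulr1 ?mul1r.
Qed.

Lemma weight_prod0 s (q : pred 'I_m) : s \notin Dperm m ->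
  \prod_(i < m) weight i (kind_of s i) (q i) = 0.
Proof.
rewrite inE negb_forall => /existsP[i Di]; rewrite (bigD1 i) //=.
suff -> : weight i (kind_of s i) (q i) = 0 by rewrite mul0r.
move: Di; rewrite /letter /kind_of /weight -(inj_eq val_inj) /=.
by case: (~~ odd i) => /=; case: ltngtP => // _ _; case: (_ < _)%N.
Qed.

Lemma sum_Dperm (q : 'S_m -> pred 'I_m) :
  \sum_(s in Dperm m) \prod_(i < m) weight i (kind_of s i) (q s i)
  = \sum_s \prod_(i < m) weight i (kind_of s i) (q s i).
Proof.
rewrite [LHS]big_mkcond; apply: eq_bigr => s _.
by case: ifP => // /negbT/weight_prod0->.
Qed.

Lemma rar_fix s i : rar s i = fixpt s i && rar s i.
Proof.
rewrite andbC; apply/esym/andb_idr; rewrite /rar /fixpt => /andP[rec arec].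
apply/eqP/val_inj/eqP; rewrite eqn_leq leqNgt (contraTN (@antirecordN _ _ _) arec).
by rewrite leqNgt (contraTN (@recordN _ _ _) rec).
Qed.

(** An excedance is never an antirecord, so only the record condition remains. *)
Lemma exrecE s i : (i < s i)%N -> (exrec s i = record s i) * (nrar s i = ~~ record s i).
Proof. by move=> /antirecordN nar; rewrite /exrec /nrar nar !andbT. Qed.

Lemma exarecE s i : (s i < i)%N ->
  (exarec s i = antirecord s i) * (nrar s i = ~~ antirecord s i).
Proof. by move=> /recordN nrec; rewrite /exarec /nrar nrec andbT. Qed.

Lemma rarE s i : fixpt s i -> (rar s i = record s i) * (nrar s i = ~~ record s i).
Proof. by move=> /eqP fi; rewrite /rar /nrar (record_fix fi) !andbb. Qed.

Lemma peak_kind s i : cpeak s i -> kind_of s i = Some (false, true).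
Proof.
rewrite /cpeak /kind_of -(inj_eq val_inj) => /andP[-> gt_i] /=.
by case: ltngtP gt_i.
Qed.

Lemma dfall_kind s i : cdfall s i -> kind_of s i = Some (false, false).
Proof.
rewrite /cdfall /kind_of -(inj_eq val_inj) /= => /andP[].
by case: ltngtP => // _ _; case: ltngtP.
Qed.

Lemma val_kind s i : cval s i -> kind_of s i = Some (true, false).
Proof.
rewrite /cval /kind_of -(inj_eq val_inj) /= => /andP[].
by case: ltngtP => // _ _; case: ltngtP.
Qed.

Lemma drise_kind s i : cdrise s i -> kind_of s i = Some (true, true).
Proof.
rewrite /cdrise /kind_of -(inj_eq val_inj) => /andP[-> gt_i] /=.
by case: ltngtP gt_i.
Qed.

Lemma fix_kind s i : fixpt s i -> kind_of s i = None.
Proof. by rewrite /kind_of /fixpt => ->. Qed.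

Lemma primed_monomial s : s \in Dperm m ->
    x1 ^+ ereccpeak' s * x2 ^+ eareccdfall' s *
    y1 ^+ minval s * y2 ^+ ereccdrise' s *
    u1 ^+ nrcpeak' s * u2 ^+ nrcdfall' s *
    v1 ^+ nminval s * v2 ^+ nrcdrise' s *
    we ^+ evennrfix s * wo ^+ oddnrfix s *
    ze ^+ evenrar s * zo ^+ oddrar s
  = \prod_(i < m) weight i (kind_of s i) (special s i).
Proof.
move=> Ds; rewrite weight_prod //.
have peakE i : cpeak s i ->
    (exrec s (prec s i) = special s i) * (nrar s (prec s i) = ~~ special s i).
  move=> Hi; rewrite /special peak_kind //.
  by apply: exrecE; case/andP: Hi; rewrite permKV.
have driseE i : cdrise s i ->
    (exrec s (prec s i) = special s i) * (nrar s (prec s i) = ~~ special s i).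
  move=> Hi; rewrite /special drise_kind //.
  by apply: exrecE; case/andP: Hi; rewrite permKV.
have dfallE i : cdfall s i ->
    (exarec s (prec s i) = special s i) * (nrar s (prec s i) = ~~ special s i).
  move=> Hi; rewrite /special dfall_kind //.
  by apply: exarecE; case/andP: Hi; rewrite permKV.
have valE i : cval s i -> cycle_min s i = special s i.
  by move=> Hi; rewrite /special val_kind.
have fixE i : fixpt s i -> (rar s i = special s i) * (nrar s i = ~~ special s i).
  by move=> Hi; rewrite /special fix_kind //; apply: rarE.
do 11?[congr (_ * _)]; congr (_ ^+ _); apply: eq_card => i;
  rewrite !inE 1?(rar_fix s i) -?(andbA (fixpt s i)); apply: andb_id2l => Hi;
  by rewrite ?(peakE i Hi) ?(driseE i Hi) ?(dfallE i Hi) ?(valE i Hi) ?(fixE i Hi).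
Qed.

Lemma unprimed_monomial s : s \in Dperm m ->
    x1 ^+ eareccpeak s * x2 ^+ eareccdfall s *
    y1 ^+ minval s * y2 ^+ ereccdrise s *
    u1 ^+ nrcpeak s * u2 ^+ nrcdfall s *
    v1 ^+ nminval s * v2 ^+ nrcdrise s *
    we ^+ evennrfix s * wo ^+ oddnrfix s *
    ze ^+ evenrar s * zo ^+ oddrar s
  = \prod_(i < m) weight i (kind_of s i) (special_pos s i).
Proof.
move=> Ds; rewrite weight_prod //.
have peakE i : cpeak s i ->
    (exarec s i = special_pos s i) * (nrar s i = ~~ special_pos s i).
  by move=> Hi; rewrite /special_pos peak_kind //; apply: exarecE; case/andP: Hi.
have driseE i : cdrise s i ->
    (exrec s i = special_pos s i) * (nrar s i = ~~ special_pos s i).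
  by move=> Hi; rewrite /special_pos drise_kind //; apply: exrecE; case/andP: Hi.
have dfallE i : cdfall s i ->
    (exarec s i = special_pos s i) * (nrar s i = ~~ special_pos s i).
  by move=> Hi; rewrite /special_pos dfall_kind //; apply: exarecE; case/andP: Hi.
have valE i : cval s i -> cycle_min s i = special_pos s i.
  by move=> Hi; rewrite /special_pos val_kind.
have fixE i : fixpt s i -> (rar s i = special_pos s i) * (nrar s i = ~~ special_pos s i).
  by move=> Hi; rewrite /special_pos fix_kind //; apply: rarE.
do 11?[congr (_ * _)]; congr (_ ^+ _); apply: eq_card => i;
  rewrite !inE 1?(rar_fix s i) -?(andbA (fixpt s i)); apply: andb_id2l => Hi;
  by rewrite ?(peakE i Hi) ?(driseE i Hi) ?(dfallE i Hi) ?(valE i Hi) ?(fixE i Hi).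
Qed.

End Monomials.

(** [up] is a valley and [down] a peak; [lev_o] joins double rises and fixed points at odd letters,
    [lev_e] double falls and fixed points at even letters. At height 0 only a record-antirecord can
    give a level step. *)
Let up h := y1 + h%:R * v1.
Let down h := if h is h'.+1 then x1 + h'%:R * u1 else 0.
Let lev_o h := if h is h'.+1 then y2 + h'%:R * v2 + wo else zo.
Let lev_e h := if h is h'.+1 then x2 + h'%:R * u2 + we else ze.

Fixpoint even_path_sum (n h : nat) : R :=
  if n is n'.+1 then
    let odd_path_sum h' :=
      lev_e h' * even_path_sum n' h' + down h' * even_path_sum n' h'.-1 in
    up h * odd_path_sum h.+1 + lev_o h * odd_path_sum h
  else (h == 0%N)%:R.

Lemma sum_kinds (F : kind -> R) :
  \sum_k F k = F (Some (true, false)) + F (Some (false, true))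
    + (F None + F (Some (true, true)) + F (Some (false, false))).
Proof.
rewrite (bigD1 None) // (bigD1 (Some (true, true))) // (bigD1 (Some (true, false))) //.
rewrite (bigD1 (Some (false, true))) // (bigD1 (Some (false, false))) //= big1 ?addr0.
  by ring.
by case=> [[[] []]|].
Qed.

(** [sw] is [false] for the primed statistics and [true] for the unprimed ones, which are read on
    the inverse permutation. *)
Let wt (sw : bool) i k b := weight i (if sw then flip k else k) b.

(** Double rises and double falls keep the height and have equally many choices, so exchanging them
    permutes equal contributions. *)
Lemma sum_odd_letter sw i h (f : nat -> R) : ~~ odd i ->
  \sum_k step_weight (wt sw) i k h * f (next_height k h) = up h * f h.+1 + lev_o h * f h.
Proof.
move=> /negbTE even_i; rewrite sum_kinds /step_weight /wt /weight /up /lev_o.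
by case: sw; case: h => [|h] /=; rewrite even_i /=; ring.
Qed.

Lemma sum_even_letter sw i h (f : nat -> R) : odd i ->
  \sum_k step_weight (wt sw) i k h * f (next_height k h) = lev_e h * f h + down h * f h.-1.
Proof.
move=> odd_i; rewrite sum_kinds /step_weight /wt /weight /down /lev_e.
by case: sw; case: h => [|h] /=; rewrite odd_i /=; ring.
Qed.

Lemma even_path_sumE sw i n h : ~~ odd i ->
  path_sum (wt sw) i (n + n) h = even_path_sum n h.
Proof.
elim: n i h => [//|n IHn] i h even_i; rewrite addnS addSn.
have odd_path h' : path_sum (wt sw) i.+1 (n + n).+1 h'
    = lev_e h' * even_path_sum n h' + down h' * even_path_sum n h'.-1.
  rewrite [LHS]/= (@sum_even_letter sw i.+1 h' (path_sum (wt sw) i.+2 (n + n))) //.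
  by rewrite !IHn //= negbK.
rewrite [LHS](@sum_odd_letter sw i h (path_sum (wt sw) i.+1 (n + n).+1)) //.
by rewrite !odd_path.
Qed.

Let a := alpha x1 x2 y1 y2 u1 u2 v1 v2 we wo.
Let d := delta ze zo.

Lemma even_path_sum_Tlimit n : even_path_sum n 0 = Tlimit a d 1 n.
Proof.
apply: (@two_step_Tlimit _ a d up down lev_o lev_e _ _ _ _
  (fun h n => even_path_sum n h)
  (fun h n => lev_e h * even_path_sum n h + down h * even_path_sum n h.-1)) => //.
- by move=> h; rewrite /a /alpha /= odd_double doubleK mulrC.
- by move=> h; rewrite /a /alpha /= odd_double uphalf_double.
- by move=> k; rewrite mul0r addr0.
Qed.

Lemma Ptilde'_Tlimit n :
  Ptilde' x1 x2 y1 y2 u1 u2 v1 v2 we wo ze zo n = Tlimit a d 1 n.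
Proof.
rewrite -even_path_sum_Tlimit -(even_path_sumE false (i := 0)) // addnn -mul2n.
rewrite -sum_permutations -[RHS]sum_Dperm.
by apply: eq_bigr => s Ds; rewrite -primed_monomial.
Qed.

Lemma Ptilde_Tlimit n :
  Ptilde x1 x2 y1 y2 u1 u2 v1 v2 we wo ze zo n = Tlimit a d 1 n.
Proof.
rewrite -even_path_sum_Tlimit -(even_path_sumE true (i := 0)) // addnn -mul2n.
rewrite -sum_permutations (reindex_inj invg_inj).
transitivity (\sum_(s : 'S_(2 * n)) \prod_(i < 2 * n) weight i (kind_of s i) (special_pos s i)).
  by rewrite -sum_Dperm; apply: eq_bigr => s Ds; rewrite -unprimed_monomial.
apply: eq_bigr => s _; apply: eq_bigr => i _.
rewrite special_inv kind_of_inv /wt; congr (weight _ _ _).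
by case: (kind_of s i) => [[[] []]|].
Qed.

End Weights.

Theorem theorem4p5 (R : comNzRingType)
  (x1 x2 y1 y2 u1 u2 v1 v2 we wo ze zo : R) :
  let P' := Ptilde' x1 x2 y1 y2 u1 u2 v1 v2 we wo ze zo in
  let P := Ptilde x1 x2 y1 y2 u1 u2 v1 v2 we wo ze zo in
  let a := alpha x1 x2 y1 y2 u1 u2 v1 v2 we wo in
  let d := delta ze zo in
  [/\ is_Tfraction a d P',
      is_Tfraction a d P
    & forall n : nat, P' n = P n].
Proof.
move=> P' P a d; split=> n; last by rewrite /P' /P Ptilde'_Tlimit Ptilde_Tlimit.
  by rewrite /P' Ptilde'_Tlimit; apply: Tlimit_is_Tfraction.
by rewrite /P Ptilde_Tlimit; apply: Tlimit_is_Tfraction.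
Qed.
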